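(* Let $\Bbbk$ be a commutative ring containing the field $\mathbb Q$ of rational numbers, and let $\mathcal D=\Bbbk\langle x_1,\dots,x_d,\partial_1,\dots,\partial_d\rangle/(\partial_ix_j-x_j\partial_i-\delta_{i,j},\ x_ix_j-x_jx_i,\ \partial_i\partial_j-\partial_j\partial_i)$ be the Weyl algebra of rank $d$, graded by $\deg x_i=1$, $\deg\partial_i=-1$ and equipped with its canonical seminorm. Then $\mathcal D$ satisfies the strong identity condition.
   Context: For a $\mathbb Z$-graded ring $U$, the canonical seminorm is the family of graded left ideals $\mathsf N_{\mathsf L}^nU=U\cdot U_{\le -n}$ ($n\in\mathbb Z$), where $U_{\le -n}=\bigoplus_{p\le -n}U_p$. Put $\mathsf N_{\mathsf R}^nU_p:=\mathsf N_{\mathsf L}^{n-p}U_p$, $\mathsf N_{\mathsf R}^nU=\bigoplus_p\mathsf N_{\mathsf R}^nU_p$ (right ideals). Let $\mathfrak L^0=U/\mathsf N_{\mathsf L}^1U$, $\mathfrak R^0=U/\mathsf N_{\mathsf R}^1U$, $\mathsf A_0=U_0/\mathsf N_{\mathsf L}^1U_0$; $\mathfrak L^0$ is a graded right $\mathsf A_0$-module, $\mathfrak R^0$ a graded left $\mathsf A_0$-module. The pairing $\circledast:\mathfrak R^0\otimes_U\mathfrak L^0\to\mathsf A_0$ sends $[\alpha]\otimes[\beta]$ ($\alpha,\beta$ homogeneous) to $[\alpha\beta]$ if $\deg\alpha+\deg\beta=0$ and to $0$ otherwise. The mode transition algebra is $\mathfrak A=\mathfrak L^0\otimes_{\mathsf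 A_0}\mathfrak R^0$, with $\mathfrak A_{p,-q}=\mathfrak L^0_p\otimes_{\mathsf A_0}\mathfrak R^0_{-q}$ and product $(a\otimes b)\star(a'\otimes b')=a\otimes(b\circledast a')b'$. The strong identity condition: there exist $\mathfrak 1_n\in\mathfrak A_{n,-n}$ ($n\in\mathbb N=\{0,1,\dots\}$) such that $\mathfrak 1_n\star\mathfrak a=\mathfrak a=\mathfrak a\star\mathfrak 1_m$ for all $n,m\in\mathbb N$ and $\mathfrak a\in\mathfrak A_{n,-m}$. *)

(* Defs.v *)
From HB Require Import structures.
From mathcomp Require Import all_boot all_order all_algebra.
From mathcomp Require Import generic_quotient ring_quotient boolp.
From mathcomp Require Import finmap monalg.

Set Implicit Arguments.
Unset Strict Implicit.
Unset Printing Implicit Defensive.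

Import Order.TTheory GRing.Theory Num.Theory.
Local Open Scope ring_scope.
Local Open Scope quotient_scope.

Section Zspan.
Variable V : zmodType.

(* The smallest additive subgroup containing S. *)
Definition zspan (S : V -> Prop) : {pred V} := fun v =>
  `[< forall H : {pred V}, zmod_closed H ->
        (forall s, S s -> s \in H) -> v \in H >].

Variable S : V -> Prop.

Lemma zspan_gen s : S s -> s \in zspan S.
Proof. by move=> Ss; apply/asboolP => H _; apply. Qed.

Lemma zspan_zmod_closed : zmod_closed (zspan S).
Proof.
split=> [|u v /asboolP Su /asboolP Sv]; apply/asboolP => H HH SH.
  by case: HH.
by case: (HH) => _; apply; [apply: Su | apply: Sv].
Qed.

HB.instance Definition _ :=
  GRing.isZmodClosed.Build V (zspan S) zspan_zmod_closed.

Lemma zspan_ind (P : V -> Prop) : P 0 ->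
  (forall u v, P u -> P v -> P (u - v)) -> (forall s, S s -> P s) ->
  forall v, v \in zspan S -> P v.
Proof.
move=> P0 PB PS v /asboolP /(_ (fun x => `[< P x >])) H.
apply/asboolP/H => [|s /PS Ps]; last exact/asboolP.
by split=> [|x y /asboolP Px /asboolP Py]; apply/asboolP => //; apply: PB.
Qed.

End Zspan.

Section ZmodQuotTheory.
Variables (V : zmodType) (I : zmodClosed V).

Lemma quot_eq (u v : V) :
  (\pi_{ideal_quot I} u = \pi_{ideal_quot I} v) <-> (u - v \in I).
Proof.
split=> [/eqP|uvI]; first by rewrite -Quotient.idealrBE.
by apply/eqP; rewrite -Quotient.idealrBE.
Qed.

Lemma repr_pi (v : V) :
  exists2 i : V, i \in I & repr (\pi_{ideal_quot I} v) = v + i.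
Proof.
exists (repr (\pi_{ideal_quot I} v) - v); last by rewrite addrC subrK.
by apply/quot_eq; rewrite reprK.
Qed.

End ZmodQuotTheory.

HB.mixin Record isTwoSided (R : pzRingType) (I : R -> bool) := {
  tsMl : forall a u : R, u \in I -> a * u \in I;
  tsMr : forall a u : R, u \in I -> u * a \in I }.

#[short(type="twoSidedIdeal")]
HB.structure Definition TwoSidedIdeal (R : pzRingType) :=
  {I of GRing.ZmodClosed R I & isTwoSided R I}.

Definition ringQuot (R : pzRingType) (I : twoSidedIdeal R) : Type := {ideal_quot I}.

Section RingQuot.
Variables (R : pzRingType) (I : twoSidedIdeal R).
Local Notation Q := (ringQuot I).

HB.instance Definition _ := GRing.Zmodule.on Q.

Definition rpi (x : R) : Q := \pi_{ideal_quot I} x.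
Definition rrepr (x : Q) : R := repr (x : {ideal_quot I}).

Lemma rreprK : cancel rrepr rpi. Proof. exact: reprK. Qed.

Lemma rpi_eq u v : (rpi u = rpi v) <-> (u - v \in I).
Proof. exact: quot_eq. Qed.

Lemma rrepr_pi u : exists2 i : R, i \in I & rrepr (rpi u) = u + i.
Proof. exact: repr_pi. Qed.

Fact rpi_is_zmod_morphism : zmod_morphism rpi.
Proof. by move=> x y; rewrite /rpi raddfB. Qed.
HB.instance Definition _ :=
  GRing.isZmodMorphism.Build R Q rpi rpi_is_zmod_morphism.

Definition rquot_one : Q := rpi 1.
Definition rquot_mul (x y : Q) : Q := rpi (rrepr x * rrepr y).

Lemma rquot_mul_pi u v : rquot_mul (rpi u) (rpi v) = rpi (u * v).
Proof.
rewrite /rquot_mul; have [i iI ->] := rrepr_pi u; have [j jI ->] := rrepr_pi v.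
apply/rpi_eq; rewrite mulrDr mulrDl addrAC [u * v + _ - _]addrAC subrr add0r.
by apply: rpredD; [apply: tsMr | apply: tsMl].
Qed.

Fact rquot_mulA : associative rquot_mul.
Proof.
move=> x y z; rewrite -[x]rreprK -[y]rreprK -[z]rreprK.
by rewrite !rquot_mul_pi mulrA.
Qed.
Fact rquot_mul1 : left_id rquot_one rquot_mul.
Proof. by move=> x; rewrite -[x]rreprK rquot_mul_pi mul1r. Qed.
Fact rquot_1mul : right_id rquot_one rquot_mul.
Proof. by move=> x; rewrite -[x]rreprK rquot_mul_pi mulr1. Qed.
Fact rquot_mulDl : left_distributive rquot_mul +%R.
Proof.
move=> x y z; rewrite -[x]rreprK -[y]rreprK -[z]rreprK.
by rewrite -raddfD !rquot_mul_pi mulrDl raddfD.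
Qed.
Fact rquot_mulDr : right_distributive rquot_mul +%R.
Proof.
move=> x y z; rewrite -[x]rreprK -[y]rreprK -[z]rreprK.
by rewrite -raddfD !rquot_mul_pi mulrDr raddfD.
Qed.

HB.instance Definition _ := GRing.Zmodule_isPzRing.Build Q
  rquot_mulA rquot_mul1 rquot_1mul rquot_mulDl rquot_mulDr.

Fact rpi_is_monoid_morphism : monoid_morphism rpi.
Proof. by split=> // x y; rewrite -rquot_mul_pi. Qed.
HB.instance Definition _ :=
  GRing.isMonoidMorphism.Build R Q rpi rpi_is_monoid_morphism.

End RingQuot.

Section GenIdeal.
Variables (R : pzRingType) (S : R -> Prop).

(* The two-sided ideal generated by S: sums of products a s b with s in S. *)
Definition tsspan : {pred R} :=
  zspan (fun v => exists a s b, S s /\ v = a * s * b).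

Fact tsspan_zmod_closed : zmod_closed tsspan.
Proof. exact: zspan_zmod_closed. Qed.
HB.instance Definition _ :=
  GRing.isZmodClosed.Build R tsspan tsspan_zmod_closed.

Fact tsspan_Ml a u : u \in tsspan -> a * u \in tsspan.
Proof.
move: u; apply: zspan_ind => [|u v Hu Hv|_ [b [s [c [Ss ->]]]]].
- by rewrite mulr0 rpred0.
- by rewrite mulrBr rpredB.
- by apply: zspan_gen; exists (a * b), s, c; rewrite !mulrA.
Qed.

Fact tsspan_Mr a u : u \in tsspan -> u * a \in tsspan.
Proof.
move: u; apply: zspan_ind => [|u v Hu Hv|_ [b [s [c [Ss ->]]]]].
- by rewrite mul0r rpred0.
- by rewrite mulrBl rpredB.
- by apply: zspan_gen; exists b, s, (c * a); rewrite !mulrA.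
Qed.

HB.instance Definition _ := isTwoSided.Build R tsspan tsspan_Ml tsspan_Mr.

Lemma tsspan_gen s : S s -> s \in tsspan.
Proof. by move=> Ss; apply: zspan_gen; exists 1, s, 1; rewrite mul1r mulr1. Qed.

End GenIdeal.

(* Tensor product of a right A-module M and a left A-module N over a possibly *)
(* noncommutative ring A; right A-modules are left modules over A^c, so that  *)
(* (a : A^c) *: x stands for x a.                                             *)
Section Tensor.
Variables (A : pzRingType) (M : lmodType A^c) (N : lmodType A).

Local Notation F := ({malg int[(M * N)%type]}).
Local Notation gen x y := (<< (x, y) >> : F).

Variant tensor_rel : F -> Prop :=
| TensorDl x x' y : tensor_rel (gen (x + x') y - gen x y - gen x' y)
| TensorDr x y y' : tensor_rel (gen x (y + y') - gen x y - gen x y')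
| TensorA (a : A) x y : tensor_rel (gen ((a : A^c) *: x) y - gen x (a *: y)).

Definition tensor : Type := {ideal_quot (zspan tensor_rel)}.
HB.instance Definition _ := GRing.Zmodule.on tensor.

Definition tens (x : M) (y : N) : tensor :=
  \pi_{ideal_quot (zspan tensor_rel)} (gen x y).


Lemma tensDl x x' y : tens (x + x') y = tens x y + tens x' y.
Proof.
rewrite /tens -raddfD; apply/quot_eq; rewrite opprD addrA.
by apply: zspan_gen; apply: TensorDl.
Qed.

Lemma tensDr x y y' : tens x (y + y') = tens x y + tens x y'.
Proof.
rewrite /tens -raddfD; apply/quot_eq; rewrite opprD addrA.
by apply: zspan_gen; apply: TensorDr.
Qed.

Lemma tensA (a : A) x y : tens ((a : A^c) *: x) y = tens x (a *: y).
Proof. by apply/quot_eq/zspan_gen; apply: TensorA. Qed.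

Section Lift.
Variables (G : zmodType) (f : M -> N -> G).

Definition balanced :=
  [/\ forall x x' y, f (x + x') y = f x y + f x' y,
      forall x y y', f x (y + y') = f x y + f x y' &
      forall (a : A) x y, f ((a : A^c) *: x) y = f x (a *: y)].

Definition free_ext (g : F) : G := \sum_(k <- msupp g) f k.1 k.2 *~ g@_k.

(* The additive map tens x y |-> f x y; meaningful when f is balanced. *)
Definition tlift (t : tensor) : G :=
  free_ext (repr (t : {ideal_quot (zspan tensor_rel)})).

Lemma free_extEw (d : {fset (M * N)%type}) (g : F) :
  (msupp g `<=` d)%fset -> free_ext g = \sum_(k <- d) f k.1 k.2 *~ g@_k.
Proof.
move=> le; rewrite /free_ext (big_fset_incl _ le) //= => k _.
by move/mcoeff_outdom ->; rewrite mulr0z.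
Qed.

Fact free_ext_is_zmod_morphism : zmod_morphism free_ext.
Proof.
move=> g h; pose d := (msupp g `|` msupp h)%fset.
rewrite (@free_extEw d g) ?fsubsetUl // (@free_extEw d h) ?fsubsetUr //.
rewrite (@free_extEw d) ?msuppB_le // -sumrB.
by apply: eq_bigr => k _; rewrite mcoeffB mulrzBr.
Qed.
HB.instance Definition _ :=
  GRing.isZmodMorphism.Build F G free_ext free_ext_is_zmod_morphism.

Lemma free_extU x y : free_ext (gen x y) = f x y.
Proof. by rewrite /free_ext msuppU /= big_seq_fset1 mcoeffUU mulr1z. Qed.

Hypothesis fB : balanced.

Lemma free_ext_rel g : g \in zspan tensor_rel -> free_ext g = 0.
Proof.
case: fB => fDl fDr fA; move: g.
apply: zspan_ind => [|g h Hg Hh|_ [x x' y|x y y'|a x y]]; first exact: raddf0.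
- by rewrite raddfB /= Hg Hh subrr.
- by rewrite !raddfB /= !free_extU fDl addrAC addrK subrr.
- by rewrite !raddfB /= !free_extU fDr addrAC addrK subrr.
- by rewrite !raddfB /= !free_extU fA subrr.
Qed.

Lemma tlift_pi g : tlift (\pi_{ideal_quot (zspan tensor_rel)} g) = free_ext g.
Proof.
rewrite /tlift; have [h hI ->] := repr_pi (zspan tensor_rel) g.
by rewrite raddfD /= (free_ext_rel hI) addr0.
Qed.

Lemma tlift_tens x y : tlift (tens x y) = f x y.
Proof. by rewrite tlift_pi free_extU. Qed.

Lemma tlift_is_zmod_morphism : zmod_morphism tlift.
Proof.
move=> t t'; rewrite -[t]reprK -[t']reprK.
have -> : (\pi_{ideal_quot (zspan tensor_rel)} (repr t) : tensor) -
  \pi_{ideal_quot (zspan tensor_rel)} (repr t') =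
  \pi_{ideal_quot (zspan tensor_rel)} (repr t - repr t') by rewrite raddfB.
by rewrite !tlift_pi raddfB.
Qed.

Lemma tliftB t t' : tlift (t - t') = tlift t - tlift t'.
Proof. exact: tlift_is_zmod_morphism. Qed.

Lemma tliftD t t' : tlift (t + t') = tlift t + tlift t'.
Proof. by rewrite -[in RHS](addrK t' t) tliftB subrK. Qed.

End Lift.

Lemma eq_tlift (G : zmodType) (f g : M -> N -> G) t :
  (forall x y, f x y = g x y) -> tlift f t = tlift g t.
Proof. by move=> fg; apply: eq_bigr => k _; rewrite fg. Qed.

Lemma tlift_addf (G : zmodType) (f g : M -> N -> G) t :
  tlift (fun x y => f x y + g x y) t = tlift f t + tlift g t.
Proof.
by rewrite /tlift /free_ext -big_split; apply: eq_bigr => k _; rewrite mulrzDl.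
Qed.

End Tensor.

(* A Z-grading on U, i.e. a decomposition of U as the direct sum of its       *)
(* homogeneous components U_p with 1 in U_0 and U_p U_q included in U_(p+q),  *)
(* encoded by the projections gproj p : U -> U_p; see homog for U_p.          *)
HB.mixin Record isGraded U of GRing.PzRing U := {
  gproj : int -> U -> U;
  gproj_is_zmod_morphism : forall p, zmod_morphism (gproj p);
  gprojK : forall p q u, gproj p (gproj q u) = if p == q then gproj q u else 0;
  gproj_dec : forall u, exists2 s : seq int,
    uniq s & u = \sum_(p <- s) gproj p u;
  gproj1 : gproj 0 1 = 1;
  gproj_mul : forall p q u v, gproj p u = u -> gproj q v = v ->
    gproj (p + q) (u * v) = u * v }.

#[short(type="gradedRingType")]
HB.structure Definition GradedRing := {U of isGraded U & GRing.PzRing U}.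

HB.instance Definition _ (U : gradedRingType) p :=
  GRing.isZmodMorphism.Build U U (@gproj U p) (gproj_is_zmod_morphism p).

Section Seminorm.
Variable U : gradedRingType.
Implicit Types (p q n : int) (u v : U).

(* U_p *)
Definition homog p : {pred U} := fun u => gproj p u == u.

Lemma homogP p u : reflect (gproj p u = u) (u \in homog p).
Proof. exact: eqP. Qed.

Fact homog_zmod_closed p : zmod_closed (homog p).
Proof.
split=> [|u v /homogP Hu /homogP Hv]; apply/homogP; first by rewrite raddf0.
by rewrite raddfB /= Hu Hv.
Qed.
HB.instance Definition _ p :=
  GRing.isZmodClosed.Build U (homog p) (homog_zmod_closed p).

Lemma homog_gproj p u : gproj p u \in homog p.
Proof. by apply/homogP; rewrite gprojK eqxx. Qed.

Lemma gproj_homog p q u : u \in homog q -> gproj p u = if p == q then u else 0.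
Proof. by move/homogP => <-; rewrite gprojK. Qed.

Lemma homogM p q u v : u \in homog p -> v \in homog q -> u * v \in homog (p + q).
Proof. by move=> /homogP ? /homogP ?; apply/homogP/gproj_mul. Qed.

Lemma homog1 : 1 \in homog 0.
Proof. by apply/homogP; rewrite gproj1. Qed.

(* U_{<= n} *)
Definition homog_le n : {pred U} :=
  zspan (fun u => exists2 p, p <= n & u \in homog p).

(* The left ideals N_L^n U = U . U_{<= -n} *)
Definition NL n : {pred U} :=
  zspan (fun w => exists u v, v \in homog_le (- n) /\ w = u * v).

(* The right ideals N_R^n U, sum over p of the N_R^n U_p = N_L^{n-p} U_p,     *)
(* where N_L^m U_p is the degree p part of N_L^m U.                           *)
Definition NR n : {pred U} :=
  zspan (fun u => exists2 p, u \in homog p & u \in NL (n - p)).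

Fact homog_le_zmod_closed n : zmod_closed (homog_le n).
Proof. exact: zspan_zmod_closed. Qed.
HB.instance Definition _ n :=
  GRing.isZmodClosed.Build U (homog_le n) (homog_le_zmod_closed n).
Fact NL_zmod_closed n : zmod_closed (NL n).
Proof. exact: zspan_zmod_closed. Qed.
HB.instance Definition _ n :=
  GRing.isZmodClosed.Build U (NL n) (NL_zmod_closed n).
Fact NR_zmod_closed n : zmod_closed (NR n).
Proof. exact: zspan_zmod_closed. Qed.
HB.instance Definition _ n :=
  GRing.isZmodClosed.Build U (NR n) (NR_zmod_closed n).

Lemma gprojMr p q u v : v \in homog q -> gproj p (u * v) = gproj (p - q) u * v.
Proof.
move=> vq; have [s us def_u] := gproj_dec u.
rewrite {1}def_u mulr_suml raddf_sum /=.
under eq_bigr => r _ do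
  rewrite (gproj_homog _ (homogM (homog_gproj r u) vq)) -subr_eq.
rewrite -big_mkcond /=.
have [ps|ps] := boolP (p - q \in s).
  rewrite (eq_bigl (fun r => r == p - q)) => [|r]; last by rewrite eq_sym.
  by rewrite -big_filter filter_pred1_uniq // big_seq1.
rewrite big_hasC; last first.
  by apply/hasPn => r rs; apply: contraNneq ps => ->.
rewrite def_u raddf_sum /= mulr_suml big1_seq // => r /= rs.
rewrite gprojK; case: eqP => [E|_]; last by rewrite mul0r.
by rewrite E rs in ps.
Qed.

Lemma gprojMl p q u v : u \in homog q -> gproj p (u * v) = u * gproj (p - q) v.
Proof.
move=> uq; have [s us def_v] := gproj_dec v.
rewrite {1}def_v mulr_sumr raddf_sum /=.
under eq_bigr => r _ do
  rewrite (gproj_homog _ (homogM uq (homog_gproj r v))) addrC -subr_eq.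
rewrite -big_mkcond /=.
have [ps|ps] := boolP (p - q \in s).
  rewrite (eq_bigl (fun r => r == p - q)) => [|r]; last by rewrite eq_sym.
  by rewrite -big_filter filter_pred1_uniq // big_seq1.
rewrite big_hasC; last first.
  by apply/hasPn => r rs; apply: contraNneq ps => ->.
rewrite def_v raddf_sum /= mulr_sumr big1_seq // => r /= rs.
rewrite gprojK; case: eqP => [E|_]; last by rewrite mulr0.
by rewrite E rs in ps.
Qed.

Lemma homog_le_homog p n u : p <= n -> u \in homog p -> u \in homog_le n.
Proof. by move=> pn up; apply: zspan_gen; exists p. Qed.

Lemma homog_leM n q u v :
  u \in homog_le n -> v \in homog q -> u * v \in homog_le (n + q).
Proof.
move=> un vq; move: u un.
apply: zspan_ind => [|u u' Hu Hu'|u [p pn up]].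
- by rewrite mul0r rpred0.
- by rewrite mulrBl rpredB.
- by apply: (@homog_le_homog (p + q)); [rewrite lerD2r | apply: homogM].
Qed.

Lemma NL_mul n u v : v \in homog_le (- n) -> u * v \in NL n.
Proof. by move=> vn; apply: zspan_gen; exists u, v. Qed.

Lemma NL_Ml n u v : v \in NL n -> u * v \in NL n.
Proof.
move: v; apply: zspan_ind => [|v v' Hv Hv'|_ [a [b [bn ->]]]].
- by rewrite mulr0 rpred0.
- by rewrite mulrBr rpredB.
- by rewrite mulrA NL_mul.
Qed.

Lemma NL_Mr n q u v : u \in NL n -> v \in homog q -> u * v \in NL (n - q).
Proof.
move=> un vq; move: u un.
apply: zspan_ind => [|u u' Hu Hu'|_ [a [b [bn ->]]]].
- by rewrite mul0r rpred0.
- by rewrite mulrBl rpredB.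
- by rewrite -mulrA NL_mul // opprB addrC homog_leM.
Qed.

Lemma NL_gproj n p u : u \in NL n -> gproj p u \in NL n.
Proof.
move: u; apply: zspan_ind => [|u v Hu Hv|_ [a [b [bn ->]]]].
- by rewrite raddf0 rpred0.
- by rewrite raddfB rpredB.
move: b bn; apply: zspan_ind => [|u v Hu Hv|v [q qn vq]].
- by rewrite mulr0 raddf0 rpred0.
- by rewrite mulrBr raddfB rpredB.
- by rewrite (gprojMr _ _ vq) NL_mul // (homog_le_homog qn).
Qed.

(* U_0, as a subring *)
Record deg0 := Deg0 { deg0_val :> U; _ : deg0_val \in homog 0 }.
HB.instance Definition _ := [isSub for deg0_val].
HB.instance Definition _ := [Choice of deg0 by <:].

Fact homog0_subring_closed : subring_closed (homog 0).
Proof.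
split=> [|u v|u v]; [exact: homog1|exact: rpredB|].
by move=> u0 v0; rewrite -[X in homog X](addr0 (0 : int)) homogM.
Qed.
HB.instance Definition _ := GRing.SubChoice_isSubPzRing.Build U (homog 0) deg0
  homog0_subring_closed.

Lemma deg0_valD (a b : deg0) : deg0_val (a + b) = deg0_val a + deg0_val b.
Proof. exact: (raddfD val). Qed.
Lemma deg0_valM (a b : deg0) : deg0_val (a * b) = deg0_val a * deg0_val b.
Proof. exact: (rmorphM val). Qed.

(* N_L^1 U_0 *)
Definition NL1_0 : {pred deg0} := fun a => (a : U) \in NL 1.

Lemma NL1_0E (a : deg0) : (a \in NL1_0) = ((a : U) \in NL 1).
Proof. by []. Qed.

Fact NL1_0_zmod_closed : zmod_closed NL1_0.
Proof.
split=> [|a b]; rewrite !NL1_0E; first exact: (rpred0 (NL 1)).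
exact: (@rpredB _ (NL 1)).
Qed.
HB.instance Definition _ :=
  GRing.isZmodClosed.Build deg0 NL1_0 NL1_0_zmod_closed.
Fact NL1_0_Ml (a u : deg0) : u \in NL1_0 -> a * u \in NL1_0.
Proof. by rewrite !NL1_0E; apply: NL_Ml. Qed.
Fact NL1_0_Mr (a u : deg0) : u \in NL1_0 -> u * a \in NL1_0.
Proof.
rewrite !NL1_0E => un; rewrite -[X in NL X](subr0 (1 : int)).
by apply: NL_Mr => //; apply: valP.
Qed.
HB.instance Definition _ := isTwoSided.Build deg0 NL1_0 NL1_0_Ml NL1_0_Mr.

Definition A0 : Type := ringQuot NL1_0.
HB.instance Definition _ := GRing.PzRing.on A0.

Definition L0 : Type := {ideal_quot (NL 1)}.
HB.instance Definition _ := GRing.Zmodule.on L0.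
Definition lpi u : L0 := \pi_{ideal_quot (NL 1)} u.
Definition lrepr (x : L0) : U := repr (x : {ideal_quot (NL 1)}).

Definition R0 : Type := {ideal_quot (NR 1)}.
HB.instance Definition _ := GRing.Zmodule.on R0.
Definition rhpi u : R0 := \pi_{ideal_quot (NR 1)} u.
Definition rhrepr (y : R0) : U := repr (y : {ideal_quot (NR 1)}).

Lemma lreprK : cancel lrepr lpi. Proof. exact: reprK. Qed.
Lemma lpi_eq u v : (lpi u = lpi v) <-> (u - v \in NL 1).
Proof. exact: quot_eq. Qed.
Lemma lrepr_pi u : exists2 i, i \in NL 1 & lrepr (lpi u) = u + i.
Proof. exact: repr_pi. Qed.
Fact lpi_is_zmod_morphism : zmod_morphism lpi.
Proof. by move=> x y; rewrite /lpi raddfB. Qed.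
HB.instance Definition _ :=
  GRing.isZmodMorphism.Build U L0 lpi lpi_is_zmod_morphism.

Lemma rhreprK : cancel rhrepr rhpi. Proof. exact: reprK. Qed.
Lemma rhpi_eq u v : (rhpi u = rhpi v) <-> (u - v \in NR 1).
Proof. exact: quot_eq. Qed.
Lemma rhrepr_pi u : exists2 i, i \in NR 1 & rhrepr (rhpi u) = u + i.
Proof. exact: repr_pi. Qed.
Fact rhpi_is_zmod_morphism : zmod_morphism rhpi.
Proof. by move=> x y; rewrite /rhpi raddfB. Qed.
HB.instance Definition _ :=
  GRing.isZmodMorphism.Build U R0 rhpi rhpi_is_zmod_morphism.

Lemma NL_M0 n u (a : deg0) : u \in NL n -> u * (a : U) \in NL n.
Proof.
by move=> un; rewrite -[X in NL X](subr0 n); apply: NL_Mr => //; apply: valP.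
Qed.

Lemma NR_0M n u (a : deg0) : u \in NR n -> (a : U) * u \in NR n.
Proof.
move: u; apply: zspan_ind => [|u v Hu Hv|u [p up un]].
- by rewrite mulr0 rpred0.
- by rewrite mulrBr rpredB.
apply: zspan_gen; exists p; last exact: NL_Ml.
by rewrite -(add0r p); apply: homogM => //; apply: valP.
Qed.

Lemma NL_NR (a : deg0) n u : (a : U) \in NL n -> (a : U) * u \in NR n.
Proof.
move=> an; have [s _ ->] := gproj_dec u; rewrite mulr_sumr rpred_sum // => p _.
apply: zspan_gen; exists p; last by apply: NL_Mr => //; apply: homog_gproj.
rewrite -[X in homog X](add0r p).
by apply: homogM; [apply: valP | apply: homog_gproj].
Qed.

(* The right A0-module structure of L0: [u] [a] = [u a]. *)
Definition L0_scale (a : A0^c) (x : L0) : L0 :=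
  lpi (lrepr x * deg0_val (rrepr (a : A0))).

Lemma L0_scale_pi (a : deg0) u :
  L0_scale (rpi NL1_0 a : A0) (lpi u) = lpi (u * (a : U)).
Proof.
rewrite /L0_scale; have [b bn ->] := rrepr_pi NL1_0 a.
have [i iN ->] := lrepr_pi u; apply/lpi_eq.
rewrite deg0_valD mulrDr mulrDl addrAC [u * (a : U) + _ - _]addrAC subrr add0r.
by apply: rpredD; [apply: NL_M0 | apply: NL_Ml].
Qed.

Fact L0_scaleA (a b : A0^c) x :
  L0_scale a (L0_scale b x) = L0_scale (a * b) x.
Proof.
rewrite -[a](@rreprK deg0 NL1_0) -[b](@rreprK deg0 NL1_0) -[x]lreprK.
rewrite [X in _ _ X = _]L0_scale_pi [LHS]L0_scale_pi -mulrA -deg0_valM.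
rewrite -[LHS]L0_scale_pi.
by congr (L0_scale _ _); apply: (rmorphM (rpi NL1_0)).
Qed.
Fact L0_scale1 : left_id 1 L0_scale.
Proof.
move=> x; rewrite -[x]lreprK.
rewrite -[RHS](congr1 lpi (mulr1 _)) -[1 in RHS]/(deg0_val 1) -L0_scale_pi.
by congr (L0_scale _ _); rewrite rmorph1.
Qed.
Fact L0_scaleDr : right_distributive L0_scale +%R.
Proof.
move=> a x y; rewrite -[a](@rreprK deg0 NL1_0) -[x]lreprK -[y]lreprK -raddfD.
by rewrite !L0_scale_pi mulrDl raddfD.
Qed.
Fact L0_scaleDl x : {morph L0_scale^~ x : a b / a + b}.
Proof.
move=> a b /=; rewrite -[a](@rreprK deg0 NL1_0) -[b](@rreprK deg0 NL1_0).
rewrite -[x]lreprK -raddfD !L0_scale_pi -raddfD /=.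
by rewrite mulrDr.
Qed.
HB.instance Definition _ := GRing.Zmodule_isLmodule.Build A0^c L0
  L0_scaleA L0_scale1 L0_scaleDr L0_scaleDl.

(* The left A0-module structure of R0: [a] [u] = [a u]. *)
Definition R0_scale (a : A0) (y : R0) : R0 :=
  rhpi (deg0_val (rrepr a) * rhrepr y).

Lemma R0_scale_pi (a : deg0) u :
  R0_scale (rpi NL1_0 a) (rhpi u) = rhpi ((a : U) * u).
Proof.
rewrite /R0_scale; have [b bn ->] := rrepr_pi NL1_0 a.
have [i iN ->] := rhrepr_pi u; apply/rhpi_eq.
rewrite deg0_valD mulrDr mulrDl.
rewrite addrAC [(a : U) * u + _ - _]addrAC subrr add0r.
by apply: rpredD; [apply: NL_NR | rewrite -deg0_valD; apply: NR_0M].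
Qed.

Fact R0_scaleA a b y : R0_scale a (R0_scale b y) = R0_scale (a * b) y.
Proof.
rewrite -[a](@rreprK deg0 NL1_0) -[b](@rreprK deg0 NL1_0) -[y]rhreprK.
rewrite [X in _ _ X = _]R0_scale_pi [LHS]R0_scale_pi mulrA -deg0_valM.
rewrite -[LHS]R0_scale_pi.
by congr (R0_scale _ _); apply: (rmorphM (rpi NL1_0)).
Qed.
Fact R0_scale1 : left_id 1 R0_scale.
Proof.
move=> y; rewrite -[y]rhreprK.
rewrite -[RHS](congr1 rhpi (mul1r _)) -[1 in RHS]/(deg0_val 1) -R0_scale_pi.
by congr (R0_scale _ _); rewrite rmorph1.
Qed.
Fact R0_scaleDr : right_distributive R0_scale +%R.
Proof.
move=> a x y; rewrite -[a](@rreprK deg0 NL1_0) -[x]rhreprK -[y]rhreprK -raddfD.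
by rewrite !R0_scale_pi mulrDr raddfD.
Qed.
Fact R0_scaleDl y : {morph R0_scale^~ y : a b / a + b}.
Proof.
move=> a b /=; rewrite -[a](@rreprK deg0 NL1_0) -[b](@rreprK deg0 NL1_0).
rewrite -[y]rhreprK -raddfD !R0_scale_pi -raddfD /=.
by rewrite mulrDl.
Qed.
HB.instance Definition _ := GRing.Zmodule_isLmodule.Build A0 R0
  R0_scaleA R0_scale1 R0_scaleDr R0_scaleDl.

Definition deg0_proj u : deg0 := Deg0 (homog_gproj 0 u).

Fact deg0_proj_is_zmod_morphism : zmod_morphism deg0_proj.
Proof. by move=> u v; apply: val_inj; rewrite /= !raddfB. Qed.
HB.instance Definition _ :=
  GRing.isZmodMorphism.Build U deg0 deg0_proj deg0_proj_is_zmod_morphism.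

Definition api u : A0 := rpi NL1_0 (deg0_proj u).
Fact api_is_zmod_morphism : zmod_morphism api.
Proof. by move=> u v; rewrite /api !raddfB. Qed.
HB.instance Definition _ :=
  GRing.isZmodMorphism.Build U A0 api api_is_zmod_morphism.

(* The pairing of [u] and [v] is [(u v)_0]: this is the biadditive extension  *)
(* of the rule on homogeneous elements, see pairing_homog.                    *)
Definition pairing (y : R0) (x : L0) : A0 := api (rhrepr y * lrepr x).

Lemma api_eq0 u : gproj 0 u \in NL 1 -> api u = 0.
Proof.
move=> H; have -> : 0 = rpi NL1_0 0 :> A0 by rewrite raddf0.
by apply/rpi_eq; rewrite subr0 NL1_0E.
Qed.

Lemma pairing_pi u v : pairing (rhpi u) (lpi v) = api (u * v).
Proof.
rewrite /pairing; have [i iN ->] := rhrepr_pi u; have [j jN ->] := lrepr_pi v.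
rewrite mulrDr mulrDl !raddfD /=.
rewrite [api (_ * j)]api_eq0 ?addr0; last by apply/NL_gproj/NL_Ml.
rewrite [api (i * v)]api_eq0 ?addr0 //.
move: i iN; apply: zspan_ind => [|i k Hi Hk|i [p ip iN]].
- by rewrite mul0r raddf0 rpred0.
- by rewrite mulrBl raddfB rpredB.
rewrite (gprojMl _ _ ip).
by have := NL_Mr iN (homog_gproj (0 - p) v); rewrite sub0r opprK subrK.
Qed.

Lemma pairing_homog p q u v : u \in homog p -> v \in homog q ->
  pairing (rhpi u) (lpi v) = if p + q == 0 then api (u * v) else 0.
Proof.
move=> up vq; rewrite pairing_pi; case: ifP => // /negbT pq.
apply: api_eq0; rewrite (gproj_homog _ (homogM up vq)) eq_sym (negPf pq).
exact: rpred0.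
Qed.

Lemma api_homog0 (a : deg0) : api a = rpi NL1_0 a.
Proof.
congr rpi; apply: val_inj => /=; rewrite (gproj_homog 0 (valP a)) //.
Qed.

(* The pairing is balanced over U. *)
Lemma pairing_balanced u w v :
  pairing (rhpi (u * w)) (lpi v) = pairing (rhpi u) (lpi (w * v)).
Proof. by rewrite !pairing_pi mulrA. Qed.

Lemma pairingDl y y' x : pairing (y + y') x = pairing y x + pairing y' x.
Proof.
rewrite -[y]rhreprK -[y']rhreprK -[x]lreprK -raddfD !pairing_pi mulrDl.
exact: raddfD.
Qed.

Lemma pairingDr y x x' : pairing y (x + x') = pairing y x + pairing y x'.
Proof.
rewrite -[y]rhreprK -[x]lreprK -[x']lreprK -raddfD !pairing_pi mulrDr.
exact: raddfD.
Qed.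

Lemma pairingAl (a : A0) y x : pairing (a *: y) x = a * pairing y x.
Proof.
rewrite -[a](@rreprK deg0 NL1_0) -[y]rhreprK -[x]lreprK.
rewrite [_ *: _]R0_scale_pi !pairing_pi -mulrA.
rewrite /api -rmorphM; congr rpi; apply: val_inj => /=.
by rewrite (gprojMl _ _ (valP (rrepr a))) subr0.
Qed.

Lemma pairingAr (a : A0) y x : pairing y ((a : A0^c) *: x) = pairing y x * a.
Proof.
rewrite -[a](@rreprK deg0 NL1_0) -[y]rhreprK -[x]lreprK.
rewrite [_ *: _]L0_scale_pi !pairing_pi mulrA.
rewrite /api -rmorphM; congr rpi; apply: val_inj => /=.
by rewrite (gprojMr _ _ (valP (rrepr a))) subr0.
Qed.

Definition MTA : Type := tensor L0 R0.
HB.instance Definition _ := GRing.Zmodule.on MTA.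

Definition star_l (x : L0) (y : R0) (b : MTA) : MTA :=
  tlift (fun x' y' => tens x (pairing y x' *: y') : MTA) b.

(* (x # y) (x' # y') = x # (pairing y x') y' for # the tensor product, and    *)
(* star is biadditive: see star_tens, starDl and starDr.                      *)
Definition star (a b : MTA) : MTA := tlift (fun x y => star_l x y b) a.

Fact star_l_balanced x y :
  balanced (fun x' y' => tens x (pairing y x' *: y') : MTA).
Proof.
split=> [x1 x2 y'|x' y1 y2|a x' y'].
- by rewrite pairingDr scalerDl tensDr.
- by rewrite scalerDr tensDr.
- by rewrite pairingAr scalerA.
Qed.

Fact star_balanced b : balanced (fun x y => star_l x y b).
Proof.
split=> [x1 x2 y|x y1 y2|a x y]; rewrite /star_l -?tlift_addf;
  apply: eq_tlift => x' y'.
- exact: tensDl.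
- by rewrite pairingDl scalerDl tensDr.
- by rewrite pairingAl -scalerA tensA.
Qed.

Lemma star_tens x y x' y' :
  star (tens x y) (tens x' y') = tens x (pairing y x' *: y').
Proof.
rewrite /star (tlift_tens (star_balanced _)) /star_l.
by rewrite (tlift_tens (star_l_balanced _ _)).
Qed.

Lemma starDl a a' b : star (a + a') b = star a b + star a' b.
Proof. exact: (tliftD (star_balanced b)). Qed.

Lemma starDr a b b' : star a (b + b') = star a b + star a b'.
Proof.
rewrite /star -tlift_addf; apply: eq_tlift => x y.
exact: (tliftD (star_l_balanced x y)).
Qed.

Definition L0_homog p (x : L0) : Prop := exists2 u, u \in homog p & x = lpi u.
Definition R0_homog p (y : R0) : Prop := exists2 u, u \in homog p & y = rhpi u.

(* The component L0_p (tensor) R0_r, realized inside the mode transition      *)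
(* algebra: it embeds there because L0_p and R0_r are direct summands of the  *)
(* A0-modules L0 and R0.                                                      *)
Definition MTA_comp p r : {pred MTA} :=
  zspan (fun t : MTA => exists x y,
    [/\ L0_homog p x, R0_homog r y & t = tens x y]).

Definition strong_identity : Prop := exists e : nat -> MTA,
  (forall n : nat, e n \in MTA_comp n%:Z (- n%:Z)) /\
  (forall (n m : nat) (a : MTA), a \in MTA_comp n%:Z (- m%:Z) ->
     star (e n) a = a /\ star a (e m) = a).

End Seminorm.

Lemma tsspan_gproj (U : gradedRingType) (S : U -> Prop)
    (homS : forall s, S s -> exists p, s \in homog p) p u :
  u \in tsspan S -> gproj p u \in tsspan S.
Proof.
move: u; apply: zspan_ind => [|u v Hu Hv|_ [a [s [b [Ss ->]]]]].
- by rewrite raddf0 rpred0.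
- by rewrite raddfB; apply: rpredB.
have [q sq] := homS s Ss; have [t _ ->] := gproj_dec a.
rewrite 2!mulr_suml raddf_sum rpred_sum //= => r _.
rewrite (gprojMl _ _ (homogM (homog_gproj r a) sq)).
by apply/tsMr/tsMl/tsspan_gen.
Qed.

(* The Weyl algebra over k of rank d: in the free algebra on the words in     *)
(* 'I_d + 'I_d, inl i stands for x_i and inr i for the i-th derivation.       *)
Definition weyl_free (k : comNzRingType) (d : nat) : Type :=
  {malg k[{fmonom ('I_d + 'I_d)%type}]}.

Section Weyl.
Variables (k : comNzRingType) (d : nat).
Local Notation gens := ('I_d + 'I_d)%type.
Local Notation F := (weyl_free k d).

HB.instance Definition _ := GRing.NzRing.on F.

Definition free_x (i : 'I_d) : F := << fmu (inl i : gens) >>.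
Definition free_d (i : 'I_d) : F := << fmu (inr i : gens) >>.

Variant weyl_rel : F -> Prop :=
| WeylDX i j : weyl_rel (free_d i * free_x j - free_x j * free_d i - (i == j)%:R)
| WeylXX i j : weyl_rel (free_x i * free_x j - free_x j * free_x i)
| WeylDD i j : weyl_rel (free_d i * free_d j - free_d j * free_d i).

Definition weyl : Type := ringQuot (tsspan weyl_rel).
HB.instance Definition _ := GRing.PzRing.on weyl.

Definition weyl_pi (f : F) : weyl := rpi (tsspan weyl_rel) f.
Definition weyl_x i : weyl := weyl_pi (free_x i).
Definition weyl_d i : weyl := weyl_pi (free_d i).

(* deg x_i = 1 and deg d_i = -1 *)
Definition weyl_deg (g : gens) : int := if g is inl _ then 1 else -1.
Definition word_deg (w : {fmonom gens}) : int :=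
  \sum_(g <- (w : seq gens)) weyl_deg g.

Definition free_proj (p : int) (f : F) : F :=
  [malg w in msupp f => if word_deg w == p then f@_w else 0].

Lemma free_projE p (f : F) w :
  (free_proj p f)@_w = if word_deg w == p then f@_w else 0.
Proof.
rewrite mcoeffE; case: ifP => // /negbT /mcoeff_outdom ->; by rewrite if_same.
Qed.

Fact free_proj_is_zmod_morphism p : zmod_morphism (free_proj p).
Proof.
move=> f g; apply/malgP => w; rewrite mcoeffB !free_projE mcoeffB.
by case: ifP; rewrite ?subr0.
Qed.
HB.instance Definition _ p := GRing.isZmodMorphism.Build F F (free_proj p)
  (free_proj_is_zmod_morphism p).

Fact free_projK p q (f : F) :
  free_proj p (free_proj q f) = if p == q then free_proj q f else 0.
Proof.
apply/malgP => w; rewrite !free_projE; have [->|pq] := eqVneq p q.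
  by rewrite free_projE; case: (word_deg w == q).
rewrite mcoeff0; case: eqP => // ->; by rewrite (negPf pq).
Qed.

Fact free_proj_dec (f : F) : exists2 s : seq int,
  uniq s & f = \sum_(p <- s) free_proj p f.
Proof.
exists (undup [seq word_deg w | w <- msupp f]); first exact: undup_uniq.
apply/malgP => w; rewrite raddf_sum /=.
under eq_bigr => p _ do rewrite free_projE eq_sym.
rewrite -big_mkcond /=; case: msuppP => [Hw|Hw].
  rewrite -big_filter filter_pred1_uniq ?undup_uniq ?big_seq1 //.
  by rewrite mem_undup map_f.
by rewrite big1_eq.
Qed.

Lemma word_degM (v w : {fmonom gens}) :
  word_deg (mmul v w) = word_deg v + word_deg w.
Proof. by rewrite /word_deg fmM big_cat. Qed.

Fact free_proj1 : free_proj 0 1 = 1.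
Proof.
apply/malgP => w; rewrite free_projE mcoeff1.
have [->|_] := eqVneq w mone; last by rewrite if_same.
by rewrite /word_deg fm1 big_nil.
Qed.

Fact free_proj_mul p q (f g : F) : free_proj p f = f -> free_proj q g = g ->
  free_proj (p + q) (f * g) = f * g.
Proof.
move=> fp gq; apply/malgP => w; rewrite free_projE.
case: (eqVneq (word_deg w)) => // wpq.
rewrite malgME raddf_sum big1 //= => v _; rewrite raddf_sum big1 //= => v' _.
rewrite mcoeffU; have [vv'|_] := eqVneq (mmul v v') w; last by rewrite mulr0n.
rewrite mulr1n; move: wpq; rewrite -vv' word_degM.
rewrite -fp -gq !free_projE; have [->|_] := eqVneq (word_deg v) p.
  have [->|_] := eqVneq (word_deg v') q; first by rewrite eqxx.
  by rewrite mulr0.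
by rewrite mul0r.
Qed.

HB.instance Definition _ := isGraded.Build F free_proj_is_zmod_morphism
  free_projK free_proj_dec free_proj1 free_proj_mul.

Lemma free_x_homog i : free_x i \in homog 1.
Proof.
apply/homogP/malgP => w; rewrite free_projE mcoeffU.
have [<-|_] := eqVneq _ w; last by rewrite mulr0n if_same.
by rewrite /word_deg fmU big_seq1.
Qed.

Lemma free_d_homog i : free_d i \in homog (-1).
Proof.
apply/homogP/malgP => w; rewrite free_projE mcoeffU.
have [<-|_] := eqVneq _ w; last by rewrite mulr0n if_same.
by rewrite /word_deg fmU big_seq1.
Qed.

Lemma weyl_rel_homog s : weyl_rel s -> exists p, s \in homog p.
Proof.
case=> [i j|i j|i j]; [exists 0|exists (1 + 1)|exists (-1 - 1)].
- apply: rpredB; last by rewrite rpredMn // homog1.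
  by apply: rpredB; [rewrite -(addNr 1)|rewrite -(subrr 1)];
    apply: homogM; rewrite ?free_x_homog ?free_d_homog.
- by apply: rpredB; apply: homogM; apply: free_x_homog.
- by apply: rpredB; apply: homogM; apply: free_d_homog.
Qed.

Lemma weyl_ideal_gproj p (f : F) :
  f \in tsspan weyl_rel -> gproj p f \in tsspan weyl_rel.
Proof. exact: (tsspan_gproj weyl_rel_homog). Qed.

Definition weyl_proj p (u : weyl) : weyl := weyl_pi (gproj p (rrepr u)).

Lemma weyl_proj_pi p (f : F) : weyl_proj p (weyl_pi f) = weyl_pi (gproj p f).
Proof.
rewrite /weyl_proj /weyl_pi; have [g gI ->] := rrepr_pi (tsspan weyl_rel) f.
by apply/rpi_eq; rewrite raddfD /= addrAC subrr add0r weyl_ideal_gproj.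
Qed.

Lemma weyl_piP (u : weyl) : exists f, u = weyl_pi f.
Proof. by exists (rrepr u); rewrite /weyl_pi rreprK. Qed.

Fact weyl_pi_is_zmod_morphism : zmod_morphism weyl_pi.
Proof. by move=> f g; rewrite /weyl_pi raddfB. Qed.
Fact weyl_pi_is_monoid_morphism : monoid_morphism weyl_pi.
Proof. by split=> [|f g]; rewrite /weyl_pi ?rmorph1 ?rmorphM. Qed.
HB.instance Definition _ :=
  GRing.isZmodMorphism.Build F weyl weyl_pi weyl_pi_is_zmod_morphism.
HB.instance Definition _ :=
  GRing.isMonoidMorphism.Build F weyl weyl_pi weyl_pi_is_monoid_morphism.

Fact weyl_proj_is_zmod_morphism p : zmod_morphism (weyl_proj p).
Proof.
move=> u v; have [f ->] := weyl_piP u; have [g ->] := weyl_piP v.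
by rewrite -raddfB !weyl_proj_pi !raddfB.
Qed.

Fact weyl_projK p q u :
  weyl_proj p (weyl_proj q u) = if p == q then weyl_proj q u else 0.
Proof.
have [f ->] := weyl_piP u; rewrite !weyl_proj_pi gprojK.
by case: ifP => _ //; rewrite raddf0.
Qed.

Fact weyl_proj_dec u : exists2 s : seq int,
  uniq s & u = \sum_(p <- s) weyl_proj p u.
Proof.
have [f ->] := weyl_piP u; have [s us def_f] := gproj_dec f; exists s => //.
rewrite {1}def_f raddf_sum; apply: eq_bigr => p _.
by rewrite weyl_proj_pi.
Qed.

Fact weyl_proj1 : weyl_proj 0 1 = 1.
Proof. by rewrite -(rmorph1 weyl_pi) weyl_proj_pi gproj1. Qed.

Fact weyl_proj_mul p q u v : weyl_proj p u = u -> weyl_proj q v = v ->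
  weyl_proj (p + q) (u * v) = u * v.
Proof.
have [f ->] := weyl_piP u; have [g ->] := weyl_piP v.
rewrite [weyl_proj p _]weyl_proj_pi [weyl_proj q _]weyl_proj_pi => <- <-.
rewrite -[weyl_pi _ * _](rmorphM weyl_pi) /= weyl_proj_pi.
by congr weyl_pi; apply: gproj_mul; rewrite gprojK eqxx.
Qed.

HB.instance Definition _ := isGraded.Build weyl weyl_proj_is_zmod_morphism
  weyl_projK weyl_proj_dec weyl_proj1 weyl_proj_mul.

Lemma weyl_x_homog i : weyl_x i \in homog 1.
Proof.
apply/homogP; rewrite [LHS]weyl_proj_pi.
by have /homogP -> := free_x_homog i.
Qed.

Lemma weyl_d_homog i : weyl_d i \in homog (-1).
Proof.
apply/homogP; rewrite [LHS]weyl_proj_pi.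
by have /homogP -> := free_d_homog i.
Qed.

End Weyl.

(* Main.v *)
Require Import Defs.
From mathcomp Require Import all_boot all_order all_algebra.
From mathcomp Require Import monalg.

(** Let E be the sum of the x_i d_i, so that [E, u] = p u for u of degree p.   *)
(** Since E lies in N_L^1, and E v lies in N_R^1 when v has degree <= 0, the   *)
(** element E_n = E (E - 1) ... (E - n + 1) acts modulo N_L^1 as n! on the     *)
(** left of the degree n part, and modulo N_R^1 as n! on the right of the      *)
(** degree -n part. But E_n is also the sum over the words w of length n of    *)
(** x_w d_rev(w), and so the sum of the [x_w / n!] (tensor) [d_rev(w)] is a    *)
(** strong identity of degree n.                                               *)

Set Implicit Arguments.
Unset Strict Implicit.
Unset Printing Implicit Defensive.

Import Order.TTheory GRing.Theory.
Local Open Scope ring_scope.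

(** A sum of tensors [a_t] (tensor) [b_t] acts through c, the sum of the a_t b_t in U: it sends [u]
    (tensor) y to [c u] (tensor) y from the left, and x (tensor) [v] to x (tensor) [v c] from the
    right. By [strong_identity_dyads] it suffices that c fixes the classes of degree n in [L0] and
    of degree -n in [R0]. For c = E_n / n!, the commutation rule [weyl_eulerE] makes each factor E -
    j act by the integer n - j ([euler_ffact_NL], [euler_ffact_NR]). The rationals serve to divide
    by n! ([weyl_rat_inv]). *)

(** * Identities given by sums of pure tensors *)

Section StarTheory.
Variable U : gradedRingType.
Implicit Types (a b : MTA U) (u v : U).

Lemma star0l b : star 0 b = 0.
Proof. by apply: (@addrI _ (star 0 b)); rewrite -starDl !addr0. Qed.

Lemma star0r a : star a 0 = 0.
Proof. by apply: (@addrI _ (star a 0)); rewrite -starDr !addr0. Qed.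

Lemma starBl a a' b : star (a - a') b = star a b - star a' b.
Proof. by apply: (@addIr _ (star a' b)); rewrite -starDl !subrK. Qed.

Lemma starBr a b b' : star a (b - b') = star a b - star a b'.
Proof. by apply: (@addIr _ (star a b')); rewrite -starDr !subrK. Qed.

Lemma star_suml (I : Type) (s : seq I) (F : I -> MTA U) b :
  star (\sum_(i <- s) F i) b = \sum_(i <- s) star (F i) b.
Proof.
elim: s => [|i s IH]; first by rewrite !big_nil star0l.
by rewrite !big_cons starDl IH.
Qed.

Lemma star_sumr (I : Type) (s : seq I) (F : I -> MTA U) a :
  star a (\sum_(i <- s) F i) = \sum_(i <- s) star a (F i).
Proof.
elim: s => [|i s IH]; first by rewrite !big_nil star0r.
by rewrite !big_cons starDr IH.
Qed.

Lemma tens0l (y : R0 U) : tens 0 y = 0 :> MTA U.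
Proof. by apply: (@addrI _ (tens 0 y : MTA U)); rewrite -[LHS]tensDl !addr0. Qed.

Lemma tens0r (x : L0 U) : tens x 0 = 0 :> MTA U.
Proof. by apply: (@addrI _ (tens x 0 : MTA U)); rewrite -[LHS]tensDr !addr0. Qed.

Lemma tens_suml (I : Type) (s : seq I) (F : I -> L0 U) (y : R0 U) :
  tens (\sum_(i <- s) F i) y = \sum_(i <- s) tens (F i) y :> MTA U.
Proof.
elim: s => [|i s IH]; first by rewrite !big_nil tens0l.
by rewrite !big_cons -IH [LHS]tensDl.
Qed.

Lemma tens_sumr (I : Type) (s : seq I) (F : I -> R0 U) (x : L0 U) :
  tens x (\sum_(i <- s) F i) = \sum_(i <- s) tens x (F i) :> MTA U.
Proof.
elim: s => [|i s IH]; first by rewrite !big_nil tens0r.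
by rewrite !big_cons -IH [LHS]tensDr.
Qed.

(** The degrees of [v] and [w] cancel, so [w * v] lies in U_0 and itself represents the scalar. *)
Lemma pairing_scale_lpi u v w p : v \in homog p -> w \in homog (- p) ->
  (pairing (rhpi w) (lpi v) : (A0 U)^c) *: lpi u = lpi (u * (w * v)).
Proof.
move=> vp wp; rewrite pairing_pi.
have H : w * v \in homog 0 by rewrite -(addNr p) homogM.
by rewrite (api_homog0 (Deg0 H)) [LHS]L0_scale_pi.
Qed.

Lemma pairing_scale_rhpi u v w p : v \in homog p -> w \in homog (- p) ->
  pairing (rhpi w) (lpi v) *: rhpi u = rhpi (w * v * u).
Proof.
move=> vp wp; rewrite pairing_pi.
have H : w * v \in homog 0 by rewrite -(addNr p) homogM.
by rewrite (api_homog0 (Deg0 H)) [LHS]R0_scale_pi.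
Qed.

Definition dyads (s : seq (U * U)) : MTA U :=
  \sum_(t <- s) tens (lpi t.1) (rhpi t.2).

Variables (p : int) (s : seq (U * U)).
Hypothesis s_homog : {in s, forall t, t.1 \in homog p /\ t.2 \in homog (- p)}.

Lemma dyads_comp : dyads s \in @MTA_comp U p (- p).
Proof.
rewrite /dyads; elim: s s_homog => [|t r IH] rh.
  by rewrite big_nil; have [] := zspan_zmod_closed (fun t : MTA U =>
    exists x y, [/\ L0_homog p x, R0_homog (- p) y & t = tens x y]).
rewrite big_cons; apply: (@rpredD _ (zspan _)).
  have [t1 t2] := rh t (mem_head _ _).
  by apply: zspan_gen; exists (lpi t.1), (rhpi t.2); split=> //;
    [exists t.1 | exists t.2].
by apply: IH => t' t'r; apply: rh; rewrite inE t'r orbT.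
Qed.

(** Each scalar [t.2 u] moves across the tensor sign to the left factor, where it yields
    [t.1 t.2 u]. *)
Lemma star_dyads_l u (y : R0 U) : u \in homog p ->
  (\sum_(t <- s) t.1 * t.2) * u - u \in NL 1 ->
  star (dyads s) (tens (lpi u) y) = tens (lpi u) y.
Proof.
move=> up /lpi_eq cu; rewrite /dyads star_suml -[in RHS]cu mulr_suml raddf_sum /=.
rewrite [RHS]tens_suml.
apply: eq_big_seq => t /s_homog [_ t2]; rewrite star_tens -mulrA.
by rewrite -(pairing_scale_lpi _ up t2) [RHS]tensA.
Qed.

Lemma star_dyads_r v (x : L0 U) : v \in homog (- p) ->
  v * (\sum_(t <- s) t.1 * t.2) - v \in NR 1 ->
  star (tens x (rhpi v)) (dyads s) = tens x (rhpi v).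
Proof.
move=> vp /rhpi_eq vc; rewrite /dyads star_sumr -[in RHS]vc mulr_sumr raddf_sum /=.
rewrite [RHS]tens_sumr.
apply: eq_big_seq => t /s_homog [t1 _]; rewrite star_tens mulrA.
by rewrite (pairing_scale_rhpi _ t1 vp).
Qed.

End StarTheory.

Lemma strong_identity_dyads (U : gradedRingType) :
  (forall n : nat, exists s : seq (U * U),
    [/\ {in s, forall t, t.1 \in homog n%:Z /\ t.2 \in homog (- n%:Z)},
        forall u, u \in homog n%:Z ->
          (\sum_(t <- s) t.1 * t.2) * u - u \in NL 1 &
        forall v, v \in homog (- n%:Z) ->
          v * (\sum_(t <- s) t.1 * t.2) - v \in NR 1]) ->
  strong_identity U.
Proof.
move=> /boolp.choice[s sP]; exists (fun n => dyads (s n)); split=> [n|n m a].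
  by have [sh _ _] := sP n; apply: dyads_comp.
have [nh nl _] := sP n; have [mh _ mr] := sP m.
move: a; apply: zspan_ind => [|a b [al ar] [bl br]|_ [_ [_ [[u un ->] [v vm ->] ->]]]].
- by rewrite star0l star0r.
- by rewrite starBl starBr al ar bl br.
- by split; [apply: (star_dyads_l nh); rewrite ?nl | apply: (star_dyads_r mh); rewrite ?mr].
Qed.

(** * Falling factorials of an Euler element *)

Section EulerElement.
Variables (U : gradedRingType) (r : nat) (x d : 'I_r -> U).
Hypotheses (x_homog : forall i, x i \in homog 1)
           (d_homog : forall i, d i \in homog (-1)).
Local Notation E := (\sum_i x i * d i).
Hypothesis eulerE : forall p u, u \in homog p -> E * u = u * E + u *~ p.

(* The pairs (x_w, d_rev(w)) for the words w of length n. *)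
Fixpoint words (n : nat) : seq (U * U) :=
  if n is m.+1 then
    [seq (t.1 * x i, d i * t.2) | t <- words m, i <- index_enum 'I_r]
  else [:: (1, 1)].

(* E (E - 1) ... (E - n + 1), by euler_ffactS. *)
Definition euler_ffact n : U := \sum_(t <- words n) t.1 * t.2.

Lemma words_homog (n : nat) :
  {in words n, forall t, t.1 \in homog n%:Z /\ t.2 \in homog (- n%:Z)}.
Proof.
elim: n => [|n IH] t /=; first by rewrite inE => /eqP ->; rewrite oppr0 homog1.
case/allpairsP => -[t' i] /= [/IH [t1 t2] _ ->] /=.
by rewrite -[n.+1]addn1 PoszD opprD [- _ + _]addrC !homogM.
Qed.

Lemma euler_ffact0 : euler_ffact 0 = 1.
Proof. by rewrite /euler_ffact big_seq1 mulr1. Qed.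

(** Lengthening the words inserts E between [t.1] and [t.2]; moving it to the right past [t.2], of
    degree -n, costs n copies of the product. *)
Lemma euler_ffactS (n : nat) :
  euler_ffact n.+1 = euler_ffact n * E - euler_ffact n *~ n.
Proof.
rewrite /euler_ffact big_allpairs_dep mulr_suml mulrz_suml -sumrB.
apply: eq_big_seq => t /words_homog [_ t2] /=.
transitivity (t.1 * E * t.2); last first.
  by rewrite -mulrA (eulerE t2) mulrDr mulrNz mulrN mulrA mulrzAr.
by rewrite mulr_sumr mulr_suml; apply: eq_bigr => i _; rewrite !mulrA.
Qed.

Lemma euler_NL u : u * E \in NL 1.
Proof.
apply/NL_Ml/rpred_sum => i _; apply: NL_mul.
exact: (homog_le_homog (lexx _)).
Qed.

Lemma euler_ffact_homog n : euler_ffact n \in homog 0.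
Proof.
rewrite /euler_ffact big_seq; apply: rpred_sum => t /words_homog [t1 t2].
by rewrite -(subrr n%:Z) homogM.
Qed.

(** In degree -m, N_R^1 is N_L^(m+1), which contains x_i (d_i v) because d_i v has degree -m-1. *)
Lemma euler_NR (m : nat) v : v \in homog (- m%:Z) -> E * v \in NR 1.
Proof.
move=> vm; rewrite mulr_suml; apply: rpred_sum => i _; apply: zspan_gen.
exists (- m%:Z).
  have -> : - m%:Z = 1 + -1 + - m%:Z by rewrite subrr add0r.
  by rewrite !homogM.
rewrite -mulrA; apply: NL_mul; apply: (@homog_le_homog _ (-1 - m%:Z)).
  by rewrite opprD opprK.
by rewrite homogM.
Qed.

Lemma euler_ffact_NL (n j : nat) u : u \in homog n%:Z -> (j <= n)%N ->
  euler_ffact j * u - u *+ (n ^_ j) \in NL 1.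
Proof.
move=> un; elim: j => [|j IH] jn.
  by rewrite euler_ffact0 mul1r ffactn0 subrr rpred0.
(* The factor E - j, moved past [u], becomes n - j plus a term ending in E, which lies in N_L^1. As
   j < n, the natural subtraction is exact. *)
have -> : euler_ffact j.+1 * u - u *+ (n ^_ j.+1) =
    euler_ffact j * u * E + (euler_ffact j * u - u *+ (n ^_ j)) *+ (n - j).
  rewrite euler_ffactS mulrBl -[_ * E * u]mulrA (eulerE un) mulrDr mulrA -!pmulrn.
  rewrite mulrnAr mulrnAl mulrnBl -mulrnA -ffactnSr.
  by rewrite (mulrnBr _ (ltnW jn)) !addrA.
by rewrite rpredD ?euler_NL // rpredMn // IH // ltnW.
Qed.

Lemma euler_ffact_NR (n j : nat) v : v \in homog (- n%:Z) -> (j <= n)%N ->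
  v * euler_ffact j - v *+ (n ^_ j) \in NR 1.
Proof.
move=> vn; elim: j => [|j IH] jn.
  by rewrite euler_ffact0 mulr1 ffactn0 subrr rpred0.
have vjn : v * euler_ffact j \in homog (- n%:Z).
  by rewrite -[- _]addr0 homogM ?euler_ffact_homog.
(* Here E moves to the left of an element of degree -n, so the product falls under [euler_NR]. *)
have -> : v * euler_ffact j.+1 - v *+ (n ^_ j.+1) =
    E * (v * euler_ffact j) + (v * euler_ffact j - v *+ (n ^_ j)) *+ (n - j).
  rewrite (eulerE vjn) mulrNz euler_ffactS mulrBr mulrA -!pmulrn.
  rewrite mulrnAr mulrnBl -mulrnA -ffactnSr (mulrnBr _ (ltnW jn)).
  by rewrite addrA addrA addrNK.
by rewrite rpredD ?(@euler_NR n) // rpredMn // IH // ltnW.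
Qed.

Lemma euler_strong_identity :
  (forall n : nat, exists z : U, z * n.+1%:R = 1) -> strong_identity U.
Proof.
move=> invn; apply: strong_identity_dyads => n.
have [z z0 zn] : exists2 z : U, z \in homog 0 & z * n`!%:R = 1.
  have [z] := invn (n`!).-1; rewrite prednK ?fact_gt0 // => zn.
  (* The degree 0 part is still an inverse of n!; it leaves degrees unchanged and preserves N_R^1
     from the left. *)
  exists (gproj 0 z); first exact: homog_gproj.
  by rewrite mulr_natr -raddfMn /= -mulr_natr zn gproj1.
have zC v : v * z = z * v.
  have nC w : n`!%:R * w = w * n`!%:R by rewrite mulr_natl mulr_natr.
  by rewrite -[v in LHS]mul1r -zn -(mulrA z) nC mulrA -(mulrA (z * v)) nC zn mulr1.
exists [seq (z * t.1, t.2) | t <- words n].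
have -> : \sum_(t <- [seq (z * t.1, t.2) | t <- words n]) t.1 * t.2 =
    z * euler_ffact n.
  by rewrite big_map mulr_sumr; apply: eq_bigr => t _; rewrite mulrA.
split=> [_ /mapP[t /words_homog [t1 t2] ->]|u un|v vn] /=.
- by rewrite -[X in homog X](add0r n%:Z) homogM.
- rewrite -[X in _ - X]mul1r -zn -!mulrA -mulrBr mulr_natl.
  by apply: NL_Ml; rewrite -ffactnn euler_ffact_NL.
- rewrite mulrA zC -mulrA -[X in _ - X]mul1r -zn -!mulrA -mulrBr mulr_natl.
  by apply: (NR_0M (Deg0 z0)); rewrite -ffactnn euler_ffact_NR.
Qed.

End EulerElement.

(** * Commutators with the Euler element *)

(** Since [e, -] is a derivation, its eigenvalues add under products. *)
Lemma comm_degM (R : pzRingType) (e a b : R) (p q : int) :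
  e * a = a * e + a *~ p -> e * b = b * e + b *~ q ->
  e * (a * b) = a * b * e + (a * b) *~ (p + q).
Proof.
move=> ea eb; rewrite mulrA ea mulrDl -mulrA eb mulrDr mulrA -addrA.
by rewrite mulrzDr mulrzAl mulrzAr [_ *~ q + _]addrC.
Qed.

Section EulerCommutation.
Variables (R : pzRingType) (r : nat) (x d : 'I_r -> R).
Hypotheses (dx : forall i j, d i * x j = x j * d i + (i == j)%:R)
           (xx : forall i j, x i * x j = x j * x i)
           (dd : forall i j, d i * d j = d j * d i).
Local Notation E := (\sum_i x i * d i).

Lemma euler_comm_x j : E * x j = x j * E + x j.
Proof.
have dxE i : x i * d i * x j = x j * (x i * d i) + x i * (i == j)%:R.
  by rewrite -mulrA dx mulrDr !mulrA (xx i j).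
rewrite mulr_suml mulr_sumr (eq_bigr _ (fun i _ => dxE i)) big_split /=.
congr (_ + _); rewrite (bigD1 j) //= eqxx mulr1 big1 ?addr0 // => i /negPf ->.
by rewrite mulr0.
Qed.

Lemma euler_comm_d j : E * d j = d j * E - d j.
Proof.
have dxE i : d j * (x i * d i) = x i * d i * d j + (j == i)%:R * d i.
  by rewrite mulrA dx mulrDl -!mulrA (dd j i).
rewrite mulr_suml mulr_sumr (eq_bigr _ (fun i _ => dxE i)) big_split /= -addrA.
rewrite [X in _ + X](_ : _ = 0) ?addr0 // (bigD1 j) //= eqxx mul1r.
rewrite big1 ?addr0 ?subrr // => i ij.
by rewrite eq_sym (negPf ij) mul0r.
Qed.

Lemma euler_commr z : (forall i, x i * z = z * x i) ->
  (forall i, d i * z = z * d i) -> E * z = z * E.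
Proof.
move=> xz dz; rewrite mulr_suml mulr_sumr; apply: eq_bigr => i _.
by rewrite -mulrA dz mulrA xz mulrA.
Qed.

End EulerCommutation.

(** * The Euler element of the Weyl algebra *)

Section WeylEuler.
Variables (k : comNzRingType) (d : nat).
Local Notation gens := ('I_d + 'I_d)%type.
Local Notation F := (weyl_free k d).
Local Notation W := (weyl k d).
Local Notation X := (weyl_x k).
Local Notation D := (weyl_d k).

Lemma weyl_DX (i j : 'I_d) : D i * X j = X j * D i + (i == j)%:R.
Proof.
rewrite /weyl_x /weyl_d -!rmorphM -[_%:R](rmorph_nat (@weyl_pi k d)) -raddfD.
by apply/rpi_eq; rewrite opprD addrA; apply/tsspan_gen/WeylDX.
Qed.

Lemma weyl_XX (i j : 'I_d) : X i * X j = X j * X i.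
Proof.
by rewrite /weyl_x -!rmorphM; apply/rpi_eq/tsspan_gen/WeylXX.
Qed.

Lemma weyl_DD (i j : 'I_d) : D i * D j = D j * D i.
Proof.
by rewrite /weyl_d -!rmorphM; apply/rpi_eq/tsspan_gen/WeylDD.
Qed.

Definition weyl_gen (g : gens) : W :=
  match g with inl i => X i | inr i => D i end.

Local Notation E := (\sum_i X i * D i).

Lemma euler_gen g : E * weyl_gen g = weyl_gen g * E + weyl_gen g *~ weyl_deg g.
Proof.
case: g => j.
  exact: (euler_comm_x (@weyl_DX) (@weyl_XX)).
exact: (euler_comm_d (@weyl_DX) (@weyl_DD)).
Qed.

Lemma weyl_piM (f g : F) : weyl_pi (f * g) = weyl_pi f * weyl_pi g.
Proof. exact: (rmorphM (@weyl_pi k d)). Qed.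

Lemma weyl_gen_pi g : weyl_gen g = weyl_pi (<< fmu g >> : F).
Proof. by case: g. Qed.

Lemma weyl_gen_const c g :
  weyl_gen g * weyl_pi (c%:MP : F) = weyl_pi (c%:MP : F) * weyl_gen g.
Proof.
have H : << fmu g >> * c%:MP = c%:MP * << fmu g >> :> F.
  by rewrite !malgM_def !fgmulUU mulm1 mul1m mulr1 mul1r.
by rewrite weyl_gen_pi -[LHS]weyl_piM -[RHS]weyl_piM H.
Qed.

Lemma euler_const c : E * weyl_pi (c%:MP : F) = weyl_pi (c%:MP : F) * E.
Proof.
apply: euler_commr => i.
  exact: (weyl_gen_const c (inl i)).
exact: (weyl_gen_const c (inr i)).
Qed.

(** Induction on the word: constants commute with E, and each letter adds its degree by
    [comm_degM]. *)
Lemma euler_monomial c (w : {fmonom gens}) (u := weyl_pi (<< c *g w >> : F)) :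
  E * u = u * E + u *~ word_deg w.
Proof.
rewrite {}/u; case: w => s; elim: s => [|g s IH].
  have -> : FMonom [::] = mone :> {fmonom gens} by rewrite -fmoneE.
  by rewrite /word_deg fm1 big_nil mulr0z addr0 euler_const.
have -> : << c *g FMonom (g :: s) >> =
    << fmu g >> * << c *g FMonom s >> :> F.
  rewrite malgM_def fgmulUU mul1r; congr (<< _ *g _ >>).
  by apply: val_inj; rewrite /= fmM fmU.
rewrite weyl_piM -weyl_gen_pi /word_deg /= big_cons.
exact: (comm_degM (euler_gen g) IH).
Qed.

Lemma weyl_eulerE p (u : W) : u \in homog p -> E * u = u * E + u *~ p.
Proof.
(* Replacing the lift [f] by its degree p part leaves only words of degree p. *)
have [f ->] := weyl_piP u => /homogP <-; rewrite [gproj p _]weyl_proj_pi.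
rewrite [gproj p f]monalgE raddf_sum /= mulr_sumr mulr_suml mulrz_suml -big_split.
apply: eq_big_seq => w; rewrite -mcoeff_neq0 free_projE.
have [<- _|_] := eqVneq (word_deg w) p; last by rewrite eqxx.
exact: euler_monomial.
Qed.

Lemma weyl_rat_inv (iota : {rmorphism rat -> k}) (n : nat) :
  exists z : W, z * n.+1%:R = 1.
Proof.
exists (weyl_pi ((iota n.+1%:R^-1)%:MP : F)).
have inv_n : iota n.+1%:R^-1 * n.+1%:R = 1.
  by rewrite -(rmorph_nat iota) -rmorphM mulVf ?rmorph1 // Num.Theory.pnatr_eq0.
rewrite -(rmorph_nat (@weyl_pi k d)) -rmorphM -mpolyC_nat -mpolyCM inv_n.
by rewrite mpolyC1E; exact: (rmorph1 (@weyl_pi k d)).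
Qed.

End WeylEuler.

(* "k contains Q" is the ring morphism iota, injective since k is nonzero. *)
Theorem theorem12p8 (k : comNzRingType) (iota : {rmorphism rat -> k}) (d : nat) :
  strong_identity (weyl k d).
Proof.
apply: (@euler_strong_identity _ d (@weyl_x k d) (@weyl_d k d)).
- exact: weyl_x_homog.
- exact: weyl_d_homog.
- exact: weyl_eulerE.
- exact: weyl_rat_inv iota.
Qed.
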